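(* (1) If $\mathcal{C}$ and $\mathcal{C}'$ are two distinct LR-decompositions of a finite tetravalent graph $\Gamma$, then there exists $g\in \mathrm{Aut}(\Gamma)$ such that $\mathcal{C}^g=\mathcal{C}'$. (2) If $(\Gamma,\mathcal{C})$ is a finite LR-structure for which $\mathrm{Aut}^+(\Gamma,\mathcal{C})$ is a proper subgroup of $\mathrm{Aut}(\Gamma)$, then $(\Gamma,\mathcal{C})$ is self-dual.
   Context: Graphs are simple and undirected; tetravalent means 4-regular. Automorphisms act on the right, and $\mathcal{C}^g$ denotes the image under $g$. Let $\Gamma$ be a connected tetravalent graph, let $\mathcal{C}$ be a partition of the edge-set $E(\Gamma)$ into cycles (a cycle is a set of edges inducing a connected 2-regular subgraph), and let $\{\mathcal{L},\mathcal{R}\}$ be a partition of $\mathcal{C}$ such that every vertex of $\Gamma$ is incident to one cycle in $\mathcal{L}$ and one cycle in $\mathcal{R}$. Define $\mathrm{Aut}(\Gamma,\mathcal{C})=\{g\in\mathrm{Aut}(\Gamma) : \mathcal{C}^g=\mathcal{C}\}$ and $\mathrm{Aut}^+(\Gamma,\mathcal{C})=\{g\in \mathrm{Aut}(\Gamma,\mathcal{C}) : \mathcal{L}^g=\mathcal{L},\ \mathcal{R}^g=\mathcal{R}\}$. (By connectedness of $\Gamma$, a partition $\{\mathcal{L},\mathcal{R}\}$ of $\mathcal{C}$ such that every vertex of $\Gamma$ is incident to one cycle in $\mathcal{L}$ and one cycle in $\mathcal{R}$ is unique if it exists, so $\mathrm{Aut}^+(\Gamma,\mathcal{C})$ is well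 defined.) The pair $(\Gamma,\mathcal{C})$ is called an LR-structure, and $\mathcal{C}$ an LR-decomposition of $\Gamma$, if (a) $\mathrm{Aut}^+(\Gamma,\mathcal{C})$ acts transitively on $V(\Gamma)$, and (b) for every $v\in V(\Gamma)$ and every cycle $C\in\mathcal{C}$ passing through $v$, some $g\in \mathrm{Aut}^+(\Gamma,\mathcal{C})$ fixing $v$ acts as a reflection on $C$ and fixes every vertex of the other cycle in $\mathcal{C}$ passing through $v$. An LR-structure is finite if $\Gamma$ is finite. It is self-dual if $\mathrm{Aut}^+(\Gamma,\mathcal{C})$ is a proper subgroup of $\mathrm{Aut}(\Gamma,\mathcal{C})$. *)

(* Defs.v *)
From HB Require Import structures.
From mathcomp Require Import all_boot all_fingroup.

Set Implicit Arguments.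
Unset Strict Implicit.
Unset Printing Implicit Defensive.

(* A finite simple graph is a symmetric irreflexive relation e on a finType T.
   Edges are the two-element sets [set x; y] with e x y; a cycle is a set of
   edges; a decomposition is a set of cycles. Permutations of T act on
   vertices, edges, cycles and sets of cycles by 'P, 'P^*, 'P^*^* and
   'P^*^*^*, respectively. *)

Section Graph.

Variables (T : finType) (e : rel T).

Definition connected_graph : Prop := forall x y : T, connect e x y.

Definition tetravalent : Prop := forall x : T, #|[set y | e x y]| = 4.

Definition edges : {set {set T}} :=
  [set [set p.1; p.2] | p : T * T & e p.1 p.2].

Definition is_cycle (C : {set {set T}}) : Prop :=
  [/\ C \subset edges, C != set0,
      {in cover C, forall v, #|[set f in C | v \in f]| = 2} &
      {in cover C &, forall x y, connect (fun a b => [set a; b] \in C) x y}].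

Definition cycle_decomposition (CC : {set {set {set T}}}) : Prop :=
  partition CC edges /\ {in CC, forall C, is_cycle C}.

Definition LR_partition (CC L R : {set {set {set T}}}) : Prop :=
  [/\ L != R, partition [set L; R] CC &
      forall v : T, #|[set C in L | v \in cover C]| = 1 /\
                    #|[set C in R | v \in cover C]| = 1].

Definition graph_aut : {set {perm T}} :=
  [set g : {perm T} | [forall x, forall y, e (g x) (g y) == e x y]].

Definition decomp_aut (CC : {set {set {set T}}}) : {set {perm T}} :=
  [set g in graph_aut | ('P^*^*^*)%act CC g == CC].

Definition decomp_aut_plus (CC L R : {set {set {set T}}}) : {set {perm T}} :=
  [set g in decomp_aut CC |
    (('P^*^*^*)%act L g == L) && (('P^*^*^*)%act R g == R)].

(* In terms of a cyclic listing c_0, ..., c_(n-1) of the vertices of C, the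
   last clause says that g maps c_i to c_(k-i) for some k: g reverses the
   orientation of C. As n > 2 for a cycle C of a simple graph, g is then not
   the identity on C. *)
Definition reflection_on (C : {set {set T}}) (g : {perm T}) : Prop :=
  ('P^*^*)%act C g = C /\
  exists s : seq T,
    [/\ uniq s, C = [set [set x; next s x] | x in s] &
        {in s, forall x, g (next s x) = prev s (g x)}].

(* L and R are explicit parameters; they are determined by CC up to exchanging
   them, and decomp_aut_plus is symmetric in them. *)
Record LR_structure (CC L R : {set {set {set T}}}) : Prop := {
  LR_connected : connected_graph;
  LR_tetravalent : tetravalent;
  LR_cycles : cycle_decomposition CC;
  LR_split : LR_partition CC L R;
  LR_transitive : [transitive decomp_aut_plus CC L R, on [set: T] | 'P];
  LR_reflections : forall (v : T) (C : {set {set T}}),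
    C \in CC -> v \in cover C ->
    exists g : {perm T},
      [/\ g \in decomp_aut_plus CC L R, g v = v, reflection_on C g &
          forall D, D \in CC -> v \in cover D -> D != C ->
            {in cover D, forall w, g w = w}]
}.

Definition LR_decomposition (CC : {set {set {set T}}}) : Prop :=
  exists L R : {set {set {set T}}}, LR_structure CC L R.

Definition self_dual (CC L R : {set {set {set T}}}) : Prop :=
  decomp_aut_plus CC L R \proper decomp_aut CC.

End Graph.

(* Main.v *)
Require Import Defs.
From mathcomp Require Import all_boot all_fingroup.
From mathcomp Require Import pgroup sylow.

(* Write A for the automorphism group of the graph and G for the group of an
   LR-structure, that is, the automorphisms of both the L-adjacency l and the
   R-adjacency r. Odd order elements of G_v fix the two L-neighbours and the
   two R-neighbours of v, so G_v is a 2-group. The main point is that the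
   pointwise stabilizer in A of a cycle of the decomposition is also a 2-group.
   Hence, if S is a Sylow 2-subgroup of A_v and u is an L-neighbour of v, then
   the stabilizer of u in S is the pointwise stabilizer of the L-cycle through
   u and v. So if two LR-structures have their vertex groups at v inside S and
   agree at v, then they share the L-cycle of v, and the product of two elements
   of their groups exchanging u and v is in S; their vertex groups at u are thus
   again in a common Sylow 2-subgroup of A_u, and by connectedness the two
   structures coincide. Part (1) follows by Sylow's theorem. In part (2), A_v is
   transitive on the neighbours of v, as otherwise A would preserve L and R; so
   S is transitive on them too, and an element of S mapping an L-neighbour of v
   to an R-neighbour exchanges L and R. *)

Set Implicit Arguments.
Unset Strict Implicit.
Unset Printing Implicit Defensive.


(** * Sylow subgroups and permutation groups *)

Section SylowOrbit.

Variables (aT : finGroupType) (rT : finType) (to : {action aT &-> rT}).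

Local Open Scope group_scope.

(** Orbit-stabilizer counting: the orbit and the stabilizer in [S] are at most the orbit and the
    p-part of the stabilizer in [G], and the two products agree, so both bounds are attained. *)
Lemma Sylow_astab1 (p : nat) (G S : {group aT}) (x : rT) :
    p.-Sylow(G) S -> p.-nat #|orbit to G x| ->
  p.-Sylow('C_G[x | to]) 'C_S[x | to] /\ orbit to S x = orbit to G x.
Proof.
move=> sylS pO; have orbSG : orbit to S x \subset orbit to G x.
  by rewrite imsetS // (pHall_sub sylS).
have orb_gt0 (K : {group aT}) : 0 < #|orbit to K x|.
  by rewrite (cardD1 x) orbit_refl.
have sSG : 'C_S[x | to] \subset 'C_G[x | to] by rewrite setSI // (pHall_sub
  sylS).
have le_stab : #|'C_S[x | to]| <= (#|'C_G[x | to]|`_p)%N.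
  have pS : p.-nat #|'C_S[x | to]|.
    exact: pgroupS (subsetIl _ _) (pHall_pgroup sylS).
  by rewrite -(part_pnat_id pS) dvdn_leq // partn_dvd // cardSg.
have cardS : (#|orbit to S x| * #|'C_S[x | to]| =
              #|orbit to G x| * #|'C_G[x | to]|`_p)%N.
  rewrite card_orbit_stab (card_Hall sylS) -(card_orbit_stab to G x).
  by rewrite partnM ?cardG_gt0 // part_pnat_id.
have eq_stab : #|'C_S[x | to]| = (#|'C_G[x | to]|`_p)%N.
  apply/eqP; rewrite eqn_leq le_stab -(leq_pmul2l (orb_gt0 G)) -cardS.
  by rewrite leq_mul2r subset_leq_card ?orbT.
split; first by rewrite pHallE sSG eq_stab eqxx.
apply/eqP; rewrite eqEcard orbSG -(leq_pmul2r (cardG_gt0 'C_S[x | to])) cardS.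
by rewrite /= eq_stab leqnn.
Qed.

End SylowOrbit.

Section Permutations.

Variable T : finType.
Implicit Types (e l : rel T) (g h : {perm T}) (x y z : T).

Local Open Scope group_scope.

Lemma connect_closed_ind e (P : T -> Prop) x :
    P x -> (forall y z, P y -> e y z -> P z) ->
  forall y, connect e x y -> P y.
Proof.
move=> Px Pe y /connectP[p ep ->]; elim: p x Px ep => //= z p IHp x Px.
by case/andP=> exz; apply: IHp; apply: Pe exz.
Qed.

Lemma odd_perm_fix g x : odd #[g] -> g (g x) = x -> g x = x.
Proof.
move=> odd_g ggx.
have even_fix k : (g ^+ k.*2) x = x.
  by elim: k => [|k IHk]; rewrite ?perm1 // doubleS !expgSr !permM IHk ggx.
(* The order plus one is even, and that power of [g] is [g] itself. *)
have := even_fix #[g].+1./2; rewrite halfK /= odd_g subn0.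
by rewrite expgSr expg_order mul1g.
Qed.

(** If [z] moved, its orbit would be {z, a, b}, and 3 does not divide the order of a 2-group. *)
Lemma order3_orbit (X : {group {perm T}}) h z a b :
    2.-group X -> h \in X -> h a = b -> a != b ->  z != a -> z != b ->
    (forall g, g \in X -> [|| g z == z, g z == a | g z == b]) ->
  forall g, g \in X -> g z = z.
Proof.
move=> X2 Xh hab ab za zb Xz g Xg; apply/eqP; apply: contraT => gz.
have orbX t k : t \in orbit 'P X z -> k \in X -> k t \in orbit 'P X z.
  by case/orbitP=> j Xj <- Xk; apply/orbitP; exists (j * k);
    rewrite ?groupM //= !apermE permM.
have orb_z : z \in orbit 'P X z by apply: orbit_refl.
have orb_gz := orbX _ _ orb_z Xg.
have orb_a : a \in orbit 'P X z.
  case/or3P: (Xz g Xg) => /eqP gzE; first by rewrite gzE eqxx in gz.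
    by rewrite -gzE.
  by rewrite -(permK h a) hab -gzE orbX ?groupV.
have orb_b : b \in orbit 'P X z by rewrite -hab orbX.
have orbE : orbit 'P X z = [set z; a; b].
  apply/setP=> t; rewrite !inE; apply/idP/idP.
    by case/orbitP=> k /Xz Hk <-; rewrite /= apermE -orbA.
  by case/orP=> [/orP[]|] /eqP->.
have := pnat_dvd (dvdn_orbit 'P X z) X2.
by rewrite orbE setUC cardsU1 cards2 !inE negb_or eq_sym zb eq_sym ab za.
Qed.

Lemma graph_autP e g :
  reflect (forall x y, e (g x) (g y) = e x y) (g \in graph_aut e).
Proof.
rewrite inE; apply: (iffP forallP) => [eg x y | eg x].
  by apply/eqP; apply: (forallP (eg x)).
by apply/forallP=> y; rewrite eg.
Qed.

Lemma graph_aut_group_set e : group_set (graph_aut e).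
Proof.
apply/group_setP; split=> [|g h /graph_autP eg /graph_autP eh].
  by apply/graph_autP=> x y; rewrite !perm1.
by apply/graph_autP=> x y; rewrite !permM eh eg.
Qed.
Canonical graph_aut_group e := group (graph_aut_group_set e).

Lemma graph_aut_connect l g x y :
  g \in graph_aut l -> connect l x y -> connect l (g x) (g y).
Proof.
move/graph_autP=> lg; move: y; apply: connect_closed_ind => // y z lxy lyz.
by apply: connect_trans lxy (connect1 _); rewrite lg.
Qed.

Lemma mem_perm_stab1 (X : {set {perm T}}) g x :
  (g \in 'C_X[x | 'P]) = (g \in X) && (g x == x).
Proof. by rewrite inE; congr (_ && _); apply/astab1P/eqP. Qed.

Lemma perm_stabP (X : {set {perm T}}) (S : {set T}) g :
  reflect (g \in X /\ {in S, forall x, g x = x}) (g \in 'C_X(S | 'P)).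
Proof.
rewrite inE; apply: (iffP andP) => [[Xg /astabP] | [Xg gS]]; first by [].
by split=> //; apply/astabP.
Qed.

Lemma perm_stabJ (X : {group {perm T}}) g x :
  g \in X -> 'C_X[x | 'P] :^ g = 'C_X[g x | 'P].
Proof. by move=> Xg; rewrite conjIg conjGid // -astab1_act. Qed.

Lemma two_groupP (X : {group {perm T}}) :
  {in X, forall g, odd #[g] -> g = 1} -> 2.-group X.
Proof.
move=> oddX; apply/pgroupP=> p p_pr /(Cauchy p_pr)[x Xx ox].
case: (even_prime p_pr) => [-> // | p_odd].
by move: p_pr; rewrite -ox (oddX x) ?ox // order1.
Qed.

End Permutations.

(** * Pairs of adjacency relations *)

Section Pairs.

Variable T : finType.
Implicit Types (e l r : rel T) (g h : {perm T}) (x y z : T).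

Local Open Scope group_scope.

(* The adjacency form of an LR-structure: l and r are the adjacency relations of
   the L-edges and of the R-edges, and cycles are connected components. *)
Record LR_pair e l r : Prop := {
  pair_edge : forall x y, e x y = l x y || r x y;
  pair_disj : forall x y, l x y -> ~~ r x y;
  pair_lsym : symmetric l;
  pair_rsym : symmetric r;
  pair_ldeg : forall x, #|[set y | l x y]| = 2;
  pair_rdeg : forall x, #|[set y | r x y]| = 2;
  pair_trans : forall x y,
    exists2 g, g \in graph_aut l :&: graph_aut r & g x = y;
  pair_lrefl : forall v, exists g,
    [/\ g \in graph_aut l :&: graph_aut r,
        forall y, connect r v y -> g y = y & forall y, l v y -> g y != y];
  pair_rrefl : forall v, exists g,
    [/\ g \in graph_aut l :&: graph_aut r,
        forall y, connect l v y -> g y = y & forall y, r v y -> g y != y]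
}.

Lemma LR_pairC e l r : LR_pair e l r -> LR_pair e r l.
Proof.
case=> el dis ls rs ld rd tr lr rr; split=> //; rewrite 1?setIC //.
- by move=> x y; rewrite el orbC.
- by move=> x y rxy; apply/negP=> /dis; rewrite rxy.
Qed.

Lemma deg2_cover l x y z : #|[set t | l x t]| = 2 ->
  l x y -> l x z -> y != z -> forall w, l x w -> w = y \/ w = z.
Proof.
move=> l2 lxy lxz yz w lxw.
have /eqP yzE : [set y; z] == [set t | l x t].
  rewrite eqEcard l2 cards2 yz leqnn andbT; apply/subsetP=> t.
  by rewrite !inE => /orP[] /eqP->.
by move/setP/(_ w): yzE; rewrite !inE lxw => /orP[] /eqP; [left | right].
Qed.

Lemma deg2_other l x y : #|[set t | l x t]| = 2 -> l x y ->
  exists z, [/\ l x z, z != y & forall w, l x w -> w = y \/ w = z].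
Proof.
move=> l2 lxy; have [z] : exists z, z \in [set t | l x t] :\ y.
  apply/set0Pn; rewrite -card_gt0; move: l2.
  by rewrite (cardsD1 y) inE lxy add1n; case=> ->.
by rewrite !inE => /andP[zy lxz]; exists z; split=> //;
  apply: deg2_cover => //; rewrite eq_sym.
Qed.

Lemma pair_nbr e l r x : LR_pair e l r -> exists y, l x y.
Proof.
move=> P; have /eqP/cards2P[a [b [_ /setP/(_ a)]]] := pair_ldeg P x.
by rewrite !inE eqxx => lxa; exists a.
Qed.

(** * Reflections, edge flips and rotations of an L-cycle *)

Section Basics.

Variables (e l r : rel T).
Hypothesis P : LR_pair e l r.

Local Notation G := (graph_aut l :&: graph_aut r).
Local Notation A := (graph_aut e).

Lemma pair_autl g x y : g \in G -> l (g x) (g y) = l x y.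
Proof. by case/setIP=> /graph_autP. Qed.

Lemma pair_autr g x y : g \in G -> r (g x) (g y) = r x y.
Proof. by case/setIP=> _ /graph_autP. Qed.

Lemma pair_sub_aut : G \subset A.
Proof.
apply/subsetP=> g Gg; apply/graph_autP=> x y.
by rewrite !(pair_edge P) pair_autl ?pair_autr.
Qed.

(** The reflection at [v] moves both L-neighbours of [v], so it exchanges them. *)
Lemma reflect_l v a b : l v a -> l v b -> a != b ->
  exists g, [/\ g \in G, g v = v, g a = b, g b = a &
             forall y, connect r v y -> g y = y].
Proof.
move=> lva lvb ab; have [g [Gg gr gl]] := pair_lrefl P v.
have gv : g v = v by apply: gr; apply: connect0.
have step c d : l v c -> l v d -> c != d -> g c = d.
  move=> lvc lvd cd; case: (deg2_cover (pair_ldeg P v) lvc lvd cd (w := g c)).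
  - by rewrite -{1}gv pair_autl.
  - by move/eqP; rewrite (negbTE (gl c lvc)).
  - by [].
by exists g; split=> //; apply: step => //; rewrite eq_sym.
Qed.

(** Transitivity moves [x] to [y]; if [y] then goes to its other L-neighbour, a reflection at [y]
    corrects this. *)
Lemma flip_l x y : l x y -> exists g, [/\ g \in G, g x = y & g y = x].
Proof.
move=> lxy; have [g Gg gx] := pair_trans P x y.
have lyg : l y (g y) by rewrite -{1}gx pair_autl.
have lyx : l y x by rewrite (pair_lsym P).
case: (eqVneq (g y) x) => [gy | gyx]; first by exists g.
have [h [Gh hy hgy _ _]] := reflect_l lyg lyx gyx.
by exists (g * h); rewrite groupM // !permM gx hgy.
Qed.

(** Exchange [x] and [y], then reflect at [y]. *)
Lemma rotate_l x y z : l x y -> l y z -> z != x ->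
  exists g, [/\ g \in G, g x = y & g y = z].
Proof.
move=> lxy lyz zx; have [g [Gg gx gy]] := flip_l lxy.
have lyx : l y x by rewrite (pair_lsym P).
have [h [Gh hy _ hx _]] := reflect_l lyz lyx zx.
by exists (g * h); rewrite groupM // !permM gx gy hy hx.
Qed.

Lemma connect_lC x y : connect l x y = connect l y x.
Proof. exact: (sym_connect_sym (pair_lsym P)). Qed.

(** On the two L-neighbours of [v] the square of [g] is trivial. *)
Lemma odd_fix_pair g v : odd #[g] -> (forall w, l v w -> l v (g w)) ->
  forall w, l v w -> g w = w.
Proof.
move=> odd_g gl w lvw; apply: odd_perm_fix => //.
have [z [lvz zw lv]] := deg2_other (pair_ldeg P v) lvw.
case: (lv _ (gl _ lvw)) => [gw | gw]; first by rewrite !gw.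
case: (lv _ (gl _ lvz)) => gz; first by rewrite gw.
by move/eqP: zw; case; apply: (@perm_inj _ g); rewrite gz gw.
Qed.

End Basics.

(** * Vertex stabilizers *)

Section Stabilizers.

Variables (e l r : rel T).
Hypotheses (P : LR_pair e l r) (e_conn : connected_graph e).

Local Notation G := (graph_aut l :&: graph_aut r).
Local Notation A := (graph_aut e).

Lemma odd_stab_trivial g v : g \in G -> odd #[g] -> g v = v -> g = 1.
Proof.
move=> Gg odd_g gv; apply/permP=> y; rewrite perm1.
move: y (e_conn v y); apply: connect_closed_ind => // y z gy.
rewrite (pair_edge P) => /orP[].
  by apply: (odd_fix_pair P) => // w; rewrite -{2}gy (pair_autl _ _ Gg).
by apply: (odd_fix_pair (LR_pairC P)) => // w;
  rewrite -{2}gy (pair_autr _ _ Gg).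
Qed.

Lemma pair_stab_2group v : 2.-group 'C_G[v | 'P].
Proof.
apply: two_groupP => g; rewrite mem_perm_stab1 => /andP[Gg /eqP gv] og.
exact: odd_stab_trivial gv.
Qed.

(* Transitivity of G reduces invariance of the relation l under A to one
   vertex, and the reflections there reduce it further to one neighbour. *)
Lemma stab_invariant_l v u : l v u ->
    {in A, forall g, g v = v -> l v (g u)} -> A \subset G.
Proof.
move=> lvu Au; have GA := subsetP (pair_sub_aut P).
have Av g w : g \in A -> g v = v -> l v w -> l v (g w).
  move=> Ag gv lvw; case: (eqVneq u w) => [<- | uw]; first exact: Au.
  have [h [Gh hv hu _ _]] := reflect_l P lvu lvw uw.
  by rewrite -hu -permM Au ?permM ?hv // groupM // GA.
have Al g x y : g \in A -> l x y -> l (g x) (g y).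
  move=> Ag lxy; have [p Gp px] := pair_trans P v x.
  have [q Gq qgx] := pair_trans P v (g x).
  have Apq : p * g * q^-1 \in A by rewrite !groupM ?groupV // GA.
  rewrite -(pair_autl _ _ (groupVr Gq)) -qgx permK.
  have -> : q^-1 (g y) = (p * g * q^-1) (p^-1 y) by rewrite !permM permKV.
  apply: Av => //; first by rewrite !permM px -qgx permK.
  by rewrite -(pair_autl _ _ Gp) px permKV.
have AlE g x y : g \in A -> l (g x) (g y) = l x y.
  move=> Ag; apply/idP/idP=> [|/(Al _ _ _ Ag)]; last by [].
  by move/(Al g^-1); rewrite !permK groupV; apply.
apply/subsetP=> g Ag; apply/setIP; split; apply/graph_autP=> x y.
  exact: AlE.
have rE s t : r s t = e s t && ~~ l s t.
  rewrite (pair_edge P); case: (boolP (l s t)) => [lst | _] /=.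
    exact/negbTE/(pair_disj P).
  by rewrite andbT.
by rewrite !rE AlE //; move/graph_autP: Ag => ->.
Qed.

End Stabilizers.

(** * The pointwise stabilizer of a cycle *)

Section CycleStabilizer.

Variables (e l r : rel T).
Hypotheses (P : LR_pair e l r) (e_conn : connected_graph e).

Local Notation G := (graph_aut l :&: graph_aut r).
Local Notation A := (graph_aut e).

Lemma cycle_stabP v g : reflect
  (g \in A /\ forall y, connect l v y -> g y = y)
  (g \in 'C_A([set y | connect l v y] | 'P)).
Proof.
apply: (iffP (perm_stabP _ _ _)) => [] [Ag gv]; split=> // y.
  by move=> lvy; apply: gv; rewrite inE.
by rewrite inE; apply: gv.
Qed.

(** An element of [G] taking one vertex of the cycle into the cycle preserves the cycle, hence
    normalizes its pointwise stabilizer. *)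
Lemma cycle_stabJ v g h y :
    h \in G -> connect l v y -> connect l v (h y) ->
    g \in 'C_A([set z | connect l v z] | 'P) ->
  g ^ h \in 'C_A([set z | connect l v z] | 'P).
Proof.
move=> Gh vy vhy /cycle_stabP[Ag gfix]; have Ah :=
  subsetP (pair_sub_aut P) h Gh.
apply/cycle_stabP; split=> [|z vz]; first by rewrite groupJ.
rewrite -[in LHS](permKV h z) permJ gfix ?permKV //.
have lh : h^-1 \in graph_aut l by rewrite groupV; case/setIP: Gh.
have := graph_aut_connect lh (connect_trans (etrans (connect_lC P _ _) vhy) vz).
by rewrite permK; apply: connect_trans.
Qed.

(** [rho] rotates the cycle by one step. The third clause makes the vertices of indices i and i + 2
    the two L-neighbours of the one between them. *)
Lemma rotation_orbit v : exists rho,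
  [/\ rho \in G, forall i, l ((rho ^+ i) v) ((rho ^+ i.+1) v),
      forall i, (rho ^+ i.+2) v != (rho ^+ i) v &
      forall y, connect l v y -> exists i, y = (rho ^+ i) v].
Proof.
have [v1 lv1] := pair_nbr v P.
have [v2 [lv12 v2v _]] : exists v2, [/\ l v1 v2, v2 != v & True].
  have lv1v : l v1 v by rewrite (pair_lsym P).
  by have [v2 [? ? _]] := deg2_other (pair_ldeg P v1) lv1v; exists v2.
have [rho [Grho rv rv1]] := rotate_l P lv1 lv12 v2v.
have Gi i : rho ^+ i \in G by rewrite groupX.
have lrho i : l ((rho ^+ i) v) ((rho ^+ i.+1) v).
  by rewrite expgS permM (pair_autl _ _ (Gi i)) rv.
have rho2 i : (rho ^+ i.+2) v != (rho ^+ i) v.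
  by rewrite !expgS !permM rv rv1 (inj_eq perm_inj).
exists rho; split=> //; apply: connect_closed_ind; first by exists 0;
  rewrite perm1.
(* Adding the order of [rho] makes the index positive, so that it has a predecessor. *)
move=> y z [i ->]; have [k] : exists k, i + #[rho] = k.+1.
  by case: #[rho] (order_gt0 rho) => // n _; exists (i + n); rewrite addnS.
move=> iE; have -> : rho ^+ i = rho ^+ k.+1 by rewrite -iE expgD expg_order
  mulg1.
have lk : l ((rho ^+ k.+1) v) ((rho ^+ k) v) by rewrite (pair_lsym P).
by case/(deg2_cover (pair_ldeg P _) (lrho k.+1) lk (rho2 k)) => ->;
  [exists k.+2 | exists k].
Qed.

(* With v_i the vertices of an L-cycle in cyclic order, let k be such that the
   pointwise stabilizers in A of v_0, ..., v_j shrink up to j = k + 1 and are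
   constant thereafter. The set of odd order elements of the limit is
   normalized both by the stabilizer of v_0, ..., v_k and by the stabilizer in
   G of the cycle, and these move (v_k, v_(k+1)) to every arc. *)
Lemma cycle_stab_2group v : 2.-group 'C_A([set y | connect l v y] | 'P).
Proof.
have GA := subsetP (pair_sub_aut P).
have [rho [Grho lrho rho2 rho_orb]] := rotation_orbit v.
pose w i := (rho ^+ i) v.
have {}lrho i : l (w i) (w i.+1) by apply: lrho.
have {}rho2 i : w i.+2 != w i by apply: rho2.
have {rho_orb} w_orb y : connect l v y -> exists i, y = w i by apply: rho_orb.
have vw i : connect l v (w i).
  elim: i => [|i IHi]; first by rewrite /w perm1.
  exact: connect_trans IHi (connect1 (lrho i)).
have rhow i : rho (w i) = w i.+1 by rewrite /w expgSr permM.
pose Q j := 'C_A([set w (val i) | i : 'I_j.+1] | 'P).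
have QP j g : reflect (g \in A /\ forall i, i <= j ->
  g (w i) = w i) (g \in Q j).
  apply: (iffP (perm_stabP _ _ _)) => [] [Ag gfix]; split=> //.
    by move=> i ij; apply: gfix; apply/imsetP; exists (inord i);
      rewrite //= inordK.
  by move=> y /imsetP[i _ ->]; apply: gfix; rewrite -ltnS; apply: ltn_ord.
have QS j : Q j.+1 \subset Q j.
  apply/subsetP=> g /QP[Ag gfix]; apply/QP; split=> // i ij.
  by apply: gfix; apply: leqW.
set X := 'C_A([set y | connect l v y] | 'P).
have QX j : X \subset Q j.
  apply/subsetP=> g /cycle_stabP[Ag gfix]; apply/QP; split=> // i _.
  exact: gfix.
(* If the chain is constant at [j], conjugation by the inverse of [rho] stays inside [Q j]; as all
   these conjugates fix [w 0], the element fixes every [w i]. *)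
have stopX j : Q j \subset Q j.+1 -> Q j \subset X.
  move=> /subsetP Qj; apply/subsetP=> g Qg.
  have QJ i : g ^ (rho ^- i) \in Q j.
    elim: i => [|i IHi]; first by rewrite invg1 conjg1.
    have /Qj/QP[Ag gfix] := IHi.
    rewrite expgS invMg conjgM; apply/QP; split.
      by rewrite groupJ // groupV GA.
    move=> i' i'j; apply: (@perm_inj _ rho).
    by rewrite -{1}(permK rho (w i')) permJ permKV rhow gfix.
  have Ag := subsetP (subsetIl _ _) _ Qg.
  apply/cycle_stabP; split=> // _ /w_orb[i ->].
  have /QP[_ /(_ 0 isT)] := QJ i; rewrite /w perm1 => gv.
  apply: (@perm_inj _ (rho ^- i)).
  by rewrite -permJ permK gv.
(* At the order of [rho] minus one, the next vertex is [w 0] again. *)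
have : exists j, Q j \subset Q j.+1.
  exists #[rho].-1; apply/subsetP=> g /QP[Ag gfix]; apply/QP; split=> // i.
  rewrite leq_eqVlt prednK ?order_gt0 // => /orP[/eqP-> | ij].
    rewrite /w expg_order; have := gfix 0 isT.
    by rewrite /w expg0.
  by apply: gfix; rewrite -ltnS prednK ?order_gt0.
(* The least such index is not 0: the L-reflection at [v] is in [Q 0] and moves [w 1]. *)
case/ex_minnP=> s Qs min_s; case: s Qs min_s => [|k] Qs min_s.
  have [h [Gh hr hl]] := pair_lrefl P v.
  have lv1 : l v (w 1%N) by have := lrho 0; rewrite /w perm1.
  have hv : h v = v by apply: hr; apply: connect0.
  have /(subsetP Qs)/QP[_ /(_ 1%N isT) hw] : h \in Q 0.
    by apply/QP; split=> [|i]; [exact: GA | rewrite leqn0 => /eqP->;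
      rewrite /w perm1].
  by have := hl _ lv1; rewrite hw eqxx.
have {min_s} /subsetPn[a Qa Qa'] : ~~ (Q k \subset Q k.+1).
  by apply/negP=> /min_s; rewrite ltnn.
have {Qs QS} XQ : Q k.+1 \subset X by apply: stopX.
have [Aa afix] := QP _ _ Qa.
have aw : a (w k.+1) != w k.+1.
  apply: contra Qa' => /eqP aw; apply/QP; split=> // i.
  by rewrite leq_eqVlt => /orP[/eqP-> | /afix].
apply: two_groupP => x Xx odd_x; have [Ax xfix] := cycle_stabP _ _ Xx.
pose O := [set g in X | odd #[g]].
have OE g : (g \in O) = (g \in X) && odd #[g] by rewrite inE.
have Ox : x \in O by rewrite OE Xx.
(* The L-neighbours of [w k] are on the cycle, so [g] permutes the two R-neighbours and, having odd
   order, fixes them too. *)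
have xfix_nbr g y : g \in O -> e (w k) y -> g y = y.
  rewrite OE => /andP[/cycle_stabP[Ag gfix] odd_g].
  have gwk : g (w k) = w k by apply: gfix.
  have gl z : l (w k) z -> g z = z.
    by move=> lz; apply: gfix; apply: connect_trans (vw k) (connect1 lz).
  rewrite (pair_edge P) => /orP[/gl // | rwy].
  apply: (odd_fix_pair (LR_pairC P) odd_g) rwy => z rz.
  have : e (w k) (g z).
    by rewrite -{1}gwk (graph_autP _ _ Ag) (pair_edge P) rz orbT.
  rewrite (pair_edge P) => /orP[lgz | //].
  have gz : g z = z by apply: (@perm_inj _ g); apply: gl.
  by rewrite gz in lgz; have := pair_disj P lgz; rewrite rz.
have xfix_O g : g \in O -> g (w k) = w k.
  by rewrite OE => /andP[/cycle_stabP[_ gfix] _]; apply: gfix.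
pose M := 'N_A(O).
have MP g : g \in A -> {in X, forall h, odd #[h] -> h ^ g \in X} -> g \in M.
  move=> Ag gX; rewrite inE Ag inE; apply/subsetP=> _ /imsetP[h + ->].
  by rewrite !OE orderJ => /andP[Xh odd_h]; rewrite gX.
have MG g y : g \in G -> connect l v y -> connect l v (g y) -> g \in M.
  by move=> Gg vy vgy; apply: MP => [|h Xh _]; [exact: GA | exact:
    cycle_stabJ vgy Xh].
(* For [h] in [O], the neighbour [g^-1 (w k.+1)] of [w k] is fixed by [h], so [h ^ g] is in
   [Q k.+1], hence in [X]. *)
have MQ g : g \in Q k -> g \in M.
  case/QP=> Ag gfix; apply: MP => // h Xh odd_h; apply: (subsetP XQ).
  have [Ah hfix] := cycle_stabP _ _ Xh.
  apply/QP; split=> [|i]; first exact: groupJ.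
  rewrite leq_eqVlt => /orP[/eqP-> | ik].
    have hw : h (g^-1 (w k.+1)) = g^-1 (w k.+1).
      apply: xfix_nbr; first by rewrite OE Xh.
      rewrite -(graph_autP _ _ Ag) permKV gfix // (pair_edge P).
      by rewrite (lrho k).
    by apply: (@perm_inj _ g^-1); rewrite -[in LHS](permKV g (w k.+1)) permJ
      permK hw.
  by rewrite -{1}(gfix i ik) permJ hfix ?gfix.
have lreflM b c : l (w k) b -> l (w k) c -> b != c ->
    exists g, [/\ g \in M, g (w k) = w k & g b = c].
  move=> lb lc bc; have [g [Gg gw gb _ _]] := reflect_l P lb lc bc.
  by exists g; split=> //; apply: (MG _ (w k)); rewrite ?gw.
have rreflM b c : r (w k) b -> r (w k) c -> b != c ->
    exists g, [/\ g \in M, g (w k) = w k & g b = c].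
  move=> rb rc bc; have [g [Gg gw gb _ gl]] := reflect_l (LR_pairC P) rb rc bc.
  rewrite setIC in Gg.
  by exists g; split=> //; apply: (MG _ (w k)); rewrite ?gw.
(* If [Q k] takes [w k.+1] to an R-neighbour of [w k], the stabilizer of [w k] in [M] takes it to
   all four neighbours; with the flip of the edge, [M] is vertex-transitive. All conjugates of [x]
   under [M] fix [w k], so [x] fixes every vertex. *)
have [ra | not_ra] := boolP [exists b in Q k, r (w k) (b (w k.+1))].
  case/exists_inP: ra => b Qb rb.
  have arcs y : e (w k) y -> exists g, [/\ g \in M, g (w k) = w k & g (w k.+1)
    = y].
    rewrite (pair_edge P) => /orP[ly | ry].
      have [-> | wy] := eqVneq y (w k.+1); last first.
        by apply: lreflM ly _; rewrite 1?eq_sym // lrho.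
      exists 1; rewrite !perm1; split=> //; exact: group1.
    have [<- | by_] := eqVneq (b (w k.+1)) y.
      exists b; split=> //; first exact: MQ.
      by case/QP: Qb => _ ->.
    have [g [Mg gw gb]] := rreflM _ _ rb ry by_.
    exists (b * g); rewrite !permM gb; split=> //;
      first by rewrite groupM // MQ.
    by case/QP: Qb => _ ->.
  have [sigma [Gsigma sw sw1]] := flip_l P (lrho k).
  have Msigma : sigma \in M by apply: (MG _ (w k)); rewrite ?sw.
  have Mtrans y : exists2 g, g \in M & g (w k) = y.
    move: y (e_conn (w k) y); apply: connect_closed_ind.
      by exists 1; rewrite ?perm1 //; exact: group1.
    move=> y z [g Mg gy] yz; have Ag : g \in A by case/setIP: Mg.
    have [|h [Mh hw hz]] := arcs (g^-1 z).
      by rewrite -(graph_autP _ _ Ag) permKV gy.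
    exists (sigma * h * g); first by rewrite !groupM.
    by rewrite !permM sw hz permKV.
  apply/permP=> y; rewrite perm1; have [g Mg <-] := Mtrans y.
  have Ng : g^-1 \in 'N(O) by rewrite groupV; case/setIP: Mg.
  have /xfix_O xJ : x ^ g^-1 \in O by rewrite memJ_norm.
  apply: (@perm_inj _ g^-1).
  by rewrite -permJ permK xJ.
have lQ g : g \in Q k -> l (w k) (g (w k.+1)).
  move=> Qg; have [Ag gfix] := QP _ _ Qg.
  have : e (w k) (g (w k.+1)).
    by rewrite -{1}(gfix k (leqnn k)) (graph_autP _ _ Ag) (pair_edge P) lrho.
  rewrite (pair_edge P) => /orP[// | rg]; case/negP: not_ra.
  by apply/exists_inP; exists g.
clear -P e_conn lrho rho2 QP Qa afix aw lQ xfix odd_x Ax.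
(* Otherwise [w k.+1] only goes to L-neighbours of [w k]. For index 0, [Q 0] is the whole stabilizer
   of [v], so [A] lies in [G] and [x] is trivial. For a positive index, [a] fixes a vertex and its
   predecessor, so it must fix the successor, contrary to its choice. *)
case: k => [|k] in Qa afix aw lQ *.
  have AG : A \subset G.
    apply: (stab_invariant_l P (lrho 0)) => g Ag gw; apply: lQ.
    by apply/QP; split=> // i; rewrite leqn0 => /eqP->.
  apply: (odd_stab_trivial P e_conn (subsetP AG x Ax) odd_x).
  exact: xfix (connect0 _ v).
have lk : l (w k.+1) (w k) by rewrite (pair_lsym P).
case: (deg2_cover (pair_ldeg P _) (lrho k.+1) lk (rho2 k) (lQ a Qa)) => aw2.
  by rewrite aw2 eqxx in aw.
move/eqP: aw2; rewrite -{1}(afix k (leqnSn k)) (inj_eq perm_inj).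
by rewrite (negbTE (rho2 k)).
Qed.

End CycleStabilizer.

End Pairs.

(** * Uniqueness *)

Section Uniqueness.

Variable T : finType.
Implicit Types (e l r : rel T) (g h : {perm T}) (x y z : T).
Implicit Type X : {group {perm T}}.

Local Open Scope group_scope.

(** The images of the second L-neighbour [w] avoid [x], so they lie among [w] and the two
    R-neighbours, which [h] puts in one orbit; an orbit of size 3 is impossible. *)
Lemma two_group_fix_l e l r X z x h : LR_pair e l r ->
    2.-group X -> X \subset graph_aut e -> {in X, forall g, g z = z} ->
    l z x -> {in X, forall g, g x = x} ->
    h \in X -> h \in graph_aut r -> (forall w, r z w -> h w != w) ->
  forall w, l z w -> {in X, forall g, g w = w}.
Proof.
move=> P X2 /subsetP XA Xz lzx Xx Xh rh hmove w lzw.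
have [-> // | wx] := eqVneq w x.
have [a rza] := pair_nbr z (LR_pairC P).
have rzh : r z (h a) by rewrite -{1}(Xz h Xh) (graph_autP _ _ rh).
have ah : a != h a by rewrite eq_sym hmove.
have neq_r c : r z c -> w != c.
  by move=> rzc; apply: contraTneq rzc => <-; apply: (pair_disj P).
apply: (order3_orbit X2 Xh (erefl (h a)) ah (neq_r _ rza) (neq_r _ rzh)) => g
  Xg.
have : e z (g w) by rewrite -{1}(Xz g Xg) (graph_autP _ _ (XA g Xg)) (pair_edge
  P) lzw.
rewrite (pair_edge P) => /orP[lzg | rzg].
  case: (deg2_cover (pair_ldeg P z) lzw lzx wx lzg) => [-> | gx];
    first by rewrite eqxx.
  by rewrite -(Xx g Xg) in gx; rewrite (perm_inj gx) eqxx in wx.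
by case: (deg2_cover (pair_rdeg P z) rza rzh ah rzg) => ->; rewrite eqxx ?orbT.
Qed.

(** [X] fixes the neighbours of [z] under [l] and under [l'], while [h] moves those under [r] and
    [h'] those under [r']. *)
Lemma agree_step e l r l' r' X z x h h' :
    LR_pair e l r -> LR_pair e l' r' ->
    2.-group X -> X \subset graph_aut e ->
    {in X, forall g, g z = z} -> {in X, forall g, g x = x} -> l z x -> l' z x ->
    h \in X -> h \in graph_aut r -> (forall w, r z w -> h w != w) ->
    h' \in X -> h' \in graph_aut r' -> (forall w, r' z w -> h' w != w) ->
  l z =1 l' z /\ forall w, l z w -> {in X, forall g, g w = w}.
Proof.
move=> P P' X2 XA Xz Xx lzx l'zx Xh rh hmove Xh' r'h' h'move.
have fixl := two_group_fix_l P X2 XA Xz lzx Xx Xh rh hmove.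
have fixl' := two_group_fix_l P' X2 XA Xz l'zx Xx Xh' r'h' h'move.
split=> // w; apply/idP/idP=> lw.
  have : e z w by rewrite (pair_edge P) lw.
  rewrite (pair_edge P') => /orP[// | /h'move].
  by rewrite (fixl w lw h' Xh') eqxx.
have : e z w by rewrite (pair_edge P') lw.
rewrite (pair_edge P) => /orP[// | /hmove].
by rewrite (fixl' w lw h Xh) eqxx.
Qed.

Lemma agree_r e l r l' r' x : LR_pair e l r -> LR_pair e l' r' ->
  l x =1 l' x -> r x =1 r' x.
Proof.
move=> P P' ll' y.
have rE k s (Q : LR_pair e k s) : s x y = e x y && ~~ k x y.
  rewrite (pair_edge Q); case: (boolP (k x y)) => [kxy | _] /=.
    exact/negbTE/(pair_disj Q).
  by rewrite andbT.
by rewrite (rE _ _ P) (rE _ _ P') ll'.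
Qed.

Section TwoPairs.

Variables (e l r l' r' : rel T).
Hypotheses (P : LR_pair e l r) (P' : LR_pair e l' r').

Local Notation G := (graph_aut l :&: graph_aut r).
Local Notation H := (graph_aut l' :&: graph_aut r').
Local Notation A := (graph_aut e).

Lemma agree_walk X v u :
    2.-group X -> X \subset A -> {in X, forall g, g v = v} ->
    {in X, forall g, g u = u} -> l v u -> l v =1 l' v ->
    'C_('C_G[v | 'P])[u | 'P] \subset X -> 'C_('C_H[v | 'P])[u | 'P] \subset X
      ->
  forall y, connect l v y -> l y =1 l' y /\ {in X, forall g, g y = y}.
Proof.
move=> X2 XA Xv Xu lvu ll' /subsetP GX /subsetP HX.
have l'vu : l' v u by rewrite -ll'.
pose good y := [/\ connect l v y, connect l' v y, l y =1 l' y,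
  {in X, forall g, g y = y} & forall w, l y w -> {in X, forall g, g w = w}].
have refl_step z x : connect l v z -> connect l' v z ->
    {in X, forall g, g z = z} -> {in X, forall g, g x = x} -> l z x -> l' z x ->
  l z =1 l' z /\ forall w, l z w -> {in X, forall g, g w = w}.
  move=> vz vz' Xz Xx lzx l'zx.
  have [g [Gg gl gr]] := pair_rrefl P z; have [h [Hh hl hr]] := pair_rrefl P' z.
  have zv : connect l z v by rewrite (connect_lC P).
  have zv' : connect l' z v by rewrite (connect_lC P').
  have Xg : g \in X.
    apply: GX; rewrite !mem_perm_stab1 Gg !gl ?eqxx //.
    exact: connect_trans zv (connect1 lvu).
  have Xh : h \in X.
    apply: HX; rewrite !mem_perm_stab1 Hh !hl ?eqxx //.
    exact: connect_trans zv' (connect1 l'vu).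
  apply: (agree_step P P' X2 XA Xz Xx lzx l'zx Xg _ gr Xh _ hr).
    by case/setIP: Gg.
  by case/setIP: Hh.
suff goodD y : connect l v y -> good y by move=> y /goodD[].
move: y; apply: connect_closed_ind.
  have [_ Xl] := refl_step v u (connect0 _ _) (connect0 _ _) Xv Xu lvu l'vu.
  by split.
move=> y z [vy vy' lly Xy Xly] lyz.
have lzy : l z y by rewrite (pair_lsym P).
have l'zy : l' z y by rewrite (pair_lsym P') -lly.
have vz : connect l v z := connect_trans vy (connect1 lyz).
have vz' : connect l' v z by apply: connect_trans vy' (connect1 _);
  rewrite -lly.
have Xz := Xly z lyz.
by have [llz Xlz] := refl_step z y vz vz' Xz Xy lzy l'zy.
Qed.

(** By the reflections, the orbit is the pair of L-neighbours or all four neighbours. *)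
Lemma pnat_orbit_stab v u : l v u ->
  2.-nat #|orbit 'P 'C_A[v | 'P] u|.
Proof.
move=> lvu; set O := orbit _ _ _.
have GA := subsetP (pair_sub_aut P).
have OJ g y : g \in A -> g v = v -> y \in O -> g y \in O.
  move=> Ag gv /orbitP[h Ch <-]; apply/orbitP; exists (h * g).
    by rewrite groupM // mem_perm_stab1 Ag gv eqxx.
  by rewrite /= !apermE permM.
have Oe y : y \in O -> e v y.
  case/orbitP=> g; rewrite mem_perm_stab1 => /andP[Ag /eqP gv] <-;
    rewrite /= apermE.
  by rewrite -{1}gv (graph_autP _ _ Ag) (pair_edge P) lvu.
have Ou : u \in O by apply: orbit_refl.
have Ol y : l v y -> y \in O.
  move=> lvy; have [<- // | uy] := eqVneq u y.
  by have [g [Gg gv <- _ _]] := reflect_l P lvu lvy uy; apply: OJ => //; apply: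
    GA.
have [Or | notOr] := boolP [exists a in O, r v a].
  case/exists_inP: Or => a Oa rva.
  have -> : O = [set y | l v y] :|: [set y | r v y].
    apply/setP=> y; rewrite !inE -(pair_edge P); apply/idP/idP; first exact: Oe.
    rewrite (pair_edge P) => /orP[/Ol // | rvy].
    have [<- // | ay] := eqVneq a y.
    have [g [Gg gv <- _ _]] := reflect_l (LR_pairC P) rva rvy ay.
    by apply: OJ => //; apply: GA; rewrite setIC.
  have lr0 : [set y | l v y] :&: [set y | r v y] = set0.
    apply/setP=> y; rewrite !inE; apply/negP=> /andP[lvy].
    by apply/negP; apply: (pair_disj P).
  by rewrite cardsU (pair_ldeg P) (pair_rdeg P) lr0 cards0.
have -> : O = [set y | l v y].
  apply/setP=> y; rewrite !inE; apply/idP/idP=> [Oy | /Ol //].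
  have := Oe y Oy; rewrite (pair_edge P) => /orP[// | rvy].
  by case/negP: notOr; apply/exists_inP; exists y.
by rewrite (pair_ldeg P).
Qed.

End TwoPairs.

(** The invariant carried along edges; the R-neighbours, being the remaining ones, then agree as
    well. *)
Definition agree_at e l r l' r' w := exists S : {group {perm T}},
  [/\ 2.-Sylow('C_(graph_aut e)[w | 'P]) S,
      'C_(graph_aut l :&: graph_aut r)[w | 'P] \subset S,
      'C_(graph_aut l' :&: graph_aut r')[w | 'P] \subset S & l w =1 l' w].

(** If [n] and [n'] exchange [u] and [v], then [n' * n^-1] fixes pointwise the L-cycle shared by
    both pairs, so it lies in [S], and [S :^ n] contains both vertex groups at [u]. *)
Lemma agree_at_l e l r l' r' v u :
    LR_pair e l r -> LR_pair e l' r' -> connected_graph e ->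
    agree_at e l r l' r' v -> l v u -> agree_at e l r l' r' u.
Proof.
move=> P P' e_conn [S [sylS GS HS llv]] lvu.
have GA := subsetP (pair_sub_aut P); have HA := subsetP (pair_sub_aut P').
have l'vu : l' v u by rewrite -llv.
have SA : S \subset 'C_(graph_aut e)[v | 'P] := pHall_sub sylS.
pose R := 'C_S[u | 'P].
have RS : R \subset S := subsetIl _ _.
have memR g : (g \in R) = (g \in S) && (g u == u) by apply: mem_perm_stab1.
have walk : forall y, connect l v y -> l y =1 l' y /\ {in R, forall g, g y = y}.
  apply: (agree_walk P P' (X := [group of R]) _ _ _ _ lvu llv).
  - exact: pgroupS RS (pHall_pgroup sylS).
  - exact: subset_trans RS (subset_trans SA (subsetIl _ _)).
  - by move=> g /(subsetP RS)/(subsetP SA); rewrite mem_perm_stab1 => /andP[_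
      /eqP].
  - by move=> g; rewrite memR => /andP[_ /eqP].
  - exact: setSI.
  - exact: setSI.
pose X := 'C_(graph_aut e)([set y | connect l v y] | 'P).
have RX : R \subset X.
  apply/subsetP=> g Rg; apply/cycle_stabP; split.
    by have /(subsetP SA)/setIP[] := subsetP RS g Rg.
  by move=> y /walk[_]; apply.
(* [R] is Sylow in the stabilizer of [v] and [u], and the 2-group [X] lies between them. *)
have XR : X = R.
  have [sylR _] := Sylow_astab1 sylS (pnat_orbit_stab P lvu).
  apply: (sub_pHall sylR (cycle_stab_2group P e_conn v) RX).
  apply/subsetP=> g /cycle_stabP[Ag gfix].
  by rewrite !mem_perm_stab1 Ag !gfix ?connect0 ?connect1 ?eqxx.
have [n [Gn nv nu]] := flip_l P lvu; have [n' [Hn' n'v n'u]] := flip_l P' l'vu.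
have nn' : n' * n^-1 \in S.
  apply: (subsetP RS); rewrite -XR; apply/cycle_stabP; split.
    by rewrite groupM ?groupV; [| exact: HA | exact: GA].
  (* A fixed L-neighbour of [y] is carried along: it forces the other one to be fixed. *)
  pose fixed y := [/\ connect l v y, (n' * n^-1) y = y &
                      exists2 w, l y w & (n' * n^-1) w = w].
  have fix_v : (n' * n^-1) v = v by rewrite permM n'v -nv permK.
  have fix_u : (n' * n^-1) u = u by rewrite permM n'u -nu permK.
  suff fixedD y : connect l v y -> fixed y by move=> y /fixedD[].
  move: y; apply: connect_closed_ind.
    by split=> //; exists u.
  move=> y z [vy yfix [w lyw wfix]] lyz.
  have vz : connect l v z := connect_trans vy (connect1 lyz).
  split=> //; last by exists y; rewrite // (pair_lsym P).
  have [-> // | zw] := eqVneq z w.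
  (* [n'] preserves [l'] and [n] preserves [l], and these relations agree at [y] and at [n y]. *)
  have lyn : l y ((n' * n^-1) z).
    have ny : n y = n' y by rewrite -[in LHS]yfix permM permKV.
    have vny : connect l v (n y).
      have : connect l u (n y) by rewrite -nv graph_aut_connect //; case/setIP:
        Gn.
      exact: connect_trans (connect1 lvu).
    rewrite -(pair_autl _ _ Gn) permM permKV (walk _ vny).1 ny (pair_autl _ _
      Hn').
    by rewrite -(walk _ vy).1.
  case: (deg2_cover (pair_ldeg P y) lyz lyw zw lyn) => //.
  by rewrite -{1}wfix => /perm_inj zw'; rewrite zw' eqxx in zw.
have vu : connect l v u := connect1 lvu.
exists (S :^ n)%G; split; last by case: (walk u vu).
- by rewrite -nv -perm_stabJ ?GA // pHallJ2.
- by rewrite -nv -perm_stabJ // conjSg.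
rewrite -n'v -perm_stabJ //.
apply/subsetP=> _ /imsetP[h Hh ->]; rewrite mem_conjg -conjgM.
by rewrite groupJ // (subsetP HS).
Qed.

Lemma agree_atC e l r l' r' v : LR_pair e l r -> LR_pair e l' r' ->
  agree_at e l r l' r' v -> agree_at e r l r' l' v.
Proof.
move=> P P' [S [sylS GS HS ll]]; exists S; split=> //.
- by rewrite [graph_aut r :&: _]setIC.
- by rewrite [graph_aut r' :&: _]setIC.
exact: agree_r P P' ll.
Qed.

(** The stabilizer of [x] in [S] contains an R-reflection at [v] of either pair, so the pairs agree
    at [v]; agreement spreads along L-edges and, with the roles exchanged, along R-edges. *)
Lemma LR_pair_unique e l r l' r' (S : {group {perm T}}) v x :
    LR_pair e l r -> LR_pair e l' r' -> connected_graph e ->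
    2.-Sylow('C_(graph_aut e)[v | 'P]) S ->
    'C_(graph_aut l :&: graph_aut r)[v | 'P] \subset S ->
    'C_(graph_aut l' :&: graph_aut r')[v | 'P] \subset S ->
    l v x -> l' v x ->
  l =2 l' /\ r =2 r'.
Proof.
move=> P P' e_conn sylS GS HS lvx l'vx.
have agree_v : agree_at e l r l' r' v.
  exists S; split=> //.
  have [g [Gg gl gr]] := pair_rrefl P v; have [h [Hh hl hr]] := pair_rrefl P' v.
  have SA : S \subset 'C_(graph_aut e)[v | 'P] := pHall_sub sylS.
  have RS : 'C_S[x | 'P] \subset S := subsetIl _ _.
  have [||||||||//] := agree_step (X := [group of 'C_S[x | 'P]]) P P' _ _ _ _
    lvx l'vx
    (h := g) _ _ gr (h' := h) _ _ hr.
  - exact: pgroupS RS (pHall_pgroup sylS).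
  - exact: subset_trans RS (subset_trans SA (subsetIl _ _)).
  - by move=> t /(subsetP RS)/(subsetP SA); rewrite mem_perm_stab1 => /andP[_
      /eqP].
  - by move=> t; rewrite mem_perm_stab1 => /andP[_ /eqP].
  - rewrite mem_perm_stab1 gl ?connect1 // eqxx andbT (subsetP GS) //.
    by rewrite mem_perm_stab1 Gg gl ?eqxx.
  - by case/setIP: Gg.
  - rewrite mem_perm_stab1 hl ?connect1 // eqxx andbT (subsetP HS) //.
    by rewrite mem_perm_stab1 Hh hl ?eqxx.
  by case/setIP: Hh.
have agree y : agree_at e l r l' r' y.
  move: y (e_conn v y); apply: connect_closed_ind => // y z agree_y.
  rewrite (pair_edge P) => /orP[| ryz]; first exact: agree_at_l agree_y.
  apply: (agree_atC (LR_pairC P) (LR_pairC P')).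
  apply: agree_at_l (LR_pairC P) (LR_pairC P') e_conn _ ryz.
  exact: agree_atC agree_y.
have ll : l =2 l' by move=> y; have [? []] := agree y.
by split=> // y; apply: agree_r P P' (ll y).
Qed.

End Uniqueness.

(** * Cycle families and adjacency relations *)

Section Conjugation.

Variable T : finType.
Implicit Types (e l r : rel T) (g h : {perm T}) (x y z : T).

Local Open Scope group_scope.

Definition conj_rel g l : rel T := fun x y => l (g^-1 x) (g^-1 y).

Lemma conj_relE g l x y : conj_rel g l (g x) (g y) = l x y.
Proof. by rewrite /conj_rel !permK. Qed.

Lemma graph_aut_conj g l : graph_aut (conj_rel g l) = graph_aut l :^ g.
Proof.
apply/setP=> h; rewrite mem_conjg.
have hE x : h x = g ((h ^ g^-1) (g^-1 x)) by rewrite permJ permKV.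
apply/graph_autP/graph_autP=> hl x y.
  by rewrite -(conj_relE g) -[in LHS](permK g x) -[in LHS](permK g y) -!hE hl
    conj_relE.
by rewrite !hE conj_relE hl.
Qed.

Lemma connect_morph l l' (f : T -> T) x y :
  (forall s t, l s t -> l' (f s) (f t)) -> connect l x y ->
    connect l' (f x) (f y).
Proof.
move=> ll' lxy; move: y lxy; apply: connect_closed_ind; first exact: connect0.
by move=> y z xy /ll' yz; apply: connect_trans xy (connect1 yz).
Qed.

Lemma LR_pair_conj e l r g :
  g \in graph_aut e -> LR_pair e l r -> LR_pair e (conj_rel g l) (conj_rel g r).
Proof.
move=> Ag P; have Ag' : g^-1 \in graph_aut e by rewrite groupV.
have deg s x : (forall y, #|[set t | s y t]| = 2) ->
  #|[set y | conj_rel g s x y]| = 2.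
  move=> s2; rewrite -(s2 (g^-1 x)) -[RHS](card_imset _ (@perm_inj _ g)).
  congr #|pred_of_set _|; apply/setP=> y.
  by rewrite -[in RHS](permKV g y) mem_imset ?inE //; apply: perm_inj.
have GJ h : h \in graph_aut l :&: graph_aut r ->
    h ^ g \in graph_aut (conj_rel g l) :&: graph_aut (conj_rel g r).
  by rewrite !graph_aut_conj -conjIg memJ_conjg.
have con s x y : connect (conj_rel g s) x y -> connect s (g^-1 x) (g^-1 y).
  exact: connect_morph.
have refl (s t : rel T) v : (exists h, [/\ h \in graph_aut l :&: graph_aut r,
        forall y, connect s (g^-1 v) y -> h y = y & forall y, t (g^-1 v) y ->
          h y != y]) ->
    exists h, [/\ h \in graph_aut (conj_rel g l) :&: graph_aut (conj_rel g r),
        forall y, connect (conj_rel g s) v y -> h y = y &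
        forall y, conj_rel g t v y -> h y != y].
  case=> h [Gh hs ht]; exists (h ^ g).
  have hE y : (h ^ g) y = g (h (g^-1 y)) by rewrite -permJ permKV.
  split; first exact: GJ.
    by move=> y /con /hs hy; rewrite hE hy permKV.
  move=> y /ht; rewrite hE; apply: contraNneq => hy.
  by apply/eqP; apply: (@perm_inj _ g); rewrite hy permKV.
split.
- by move=> x y; rewrite /conj_rel -(pair_edge P) (graph_autP _ _ Ag').
- by move=> x y; apply: (pair_disj P).
- by move=> x y; apply: (pair_lsym P).
- by move=> x y; apply: (pair_rsym P).
- by move=> x; apply: deg; apply: (pair_ldeg P).
- by move=> x; apply: deg; apply: (pair_rdeg P).
- move=> x y; have [h Gh hx] := pair_trans P (g^-1 x) (g^-1 y).
  by exists (h ^ g); [exact: GJ | rewrite -[in LHS](permKV g x) permJ hx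
    permKV].
- by move=> v; apply: refl; apply: (pair_lrefl P).
by move=> v; apply: refl; apply: (pair_rrefl P).
Qed.

(** The edge set of the component of [z], from which a decomposition is rebuilt out of its adjacency
    relations. *)
Definition cycle_at l z : {set {set T}} :=
  [set [set p.1; p.2] | p : T * T & connect l z p.1 && l p.1 p.2].

Definition cycles_of l : {set {set {set T}}} := [set cycle_at l z | z : T].

Lemma edge_act x y g : ('P^*)%act [set x; y] g = [set g x; g y].
Proof. by rewrite /= setactE imsetU1 imset_set1. Qed.

Lemma cycle_at_act l l' g z :
    (forall x y, l' (g x) (g y) = l x y) ->
  ('P^*^*)%act (cycle_at l z) g = cycle_at l' (g z).
Proof.
move=> ll'; have gl x y : l x y -> l' (g x) (g y) by rewrite ll'.
have gl' x y : l' x y -> l (g^-1 x) (g^-1 y) by rewrite -ll' !permKV.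
apply/setP=> f; rewrite /= setactE; apply/imsetP/imsetP.
  case=> _ /imsetP[[x y] /= zxy ->] ->; exists (g x, g y); last exact: edge_act.
  move: zxy; rewrite !inE /= ll' => /andP[zx ->]; rewrite andbT.
  exact: connect_morph zx.
case=> [[x y]]; rewrite inE /= => /andP[zx xy] ->.
exists [set g^-1 x; g^-1 y]; last by rewrite edge_act !permKV.
apply/imsetP; exists (g^-1 x, g^-1 y) => //.
rewrite inE /= gl' // andbT -[z](permK g).
exact: connect_morph zx.
Qed.

Lemma cycles_of_act l l' g :
    (forall x y, l' (g x) (g y) = l x y) ->
  ('P^*^*^*)%act (cycles_of l) g = cycles_of l'.
Proof.
move=> ll'; apply/setP=> C; rewrite /= setactE; apply/imsetP/imsetP.
  by case=> _ /imsetP[z _ ->] ->; exists (g z); rewrite // (cycle_at_act _ ll').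
case=> z _ ->; exists (cycle_at l (g^-1 z)); first exact: imset_f.
by rewrite (cycle_at_act _ ll') permKV.
Qed.

End Conjugation.

(** * Families of cycles with one cycle through each vertex *)

Section CycleFamily.

Variables (T : finType) (e : rel T) (L : {set {set {set T}}}).
Hypothesis L_cycles : {in L, forall C, is_cycle e C}.
Hypothesis L_vertex : forall v, #|[set C in L | v \in cover C]| = 1.

Local Open Scope group_scope.

Definition cover_rel (F : {set {set {set T}}}) : rel T :=
  fun x y => [set x; y] \in cover F.

Local Notation l := (cover_rel L).

Lemma cover_rel_sym F : symmetric (cover_rel F).
Proof. by move=> x y; rewrite /cover_rel setUC. Qed.

Lemma family_uniq C D v : C \in L -> D \in L ->
  v \in cover C -> v \in cover D -> C = D.
Proof.
move=> LC LD vC vD; have /eqP/cards1P[B /setP LB] := L_vertex v.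
have := LB C; have := LB D; rewrite !inE LC LD vC vD.
by move=> /esym/eqP-> /esym/eqP->.
Qed.

Lemma family_ex v : exists2 C, C \in L & v \in cover C.
Proof.
have /eqP/cards1P[C /setP/(_ C)] := L_vertex v.
by rewrite !inE eqxx => /andP[]; exists C.
Qed.

Lemma mem_cover_edge (C : {set {set T}}) x y :
  [set x; y] \in C -> x \in cover C /\ y \in cover C.
Proof.
by move=> Cxy; split; apply/bigcupP; exists [set x; y];
  rewrite // !inE eqxx ?orbT.
Qed.

Lemma family_rel C v y : C \in L -> v \in cover C -> l v y = ([set v; y] \in C).
Proof.
move=> LC vC; apply/bigcupP/idP=> [[D LD Dvy] | Cvy]; last by exists C.
by have [vD _] := mem_cover_edge Dvy; rewrite (family_uniq LC LD vC vD).
Qed.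

Lemma family_edge C f : C \in L -> f \in C -> exists x y, f = [set x; y].
Proof.
move=> LC Cf; have [/subsetP CE _ _ _] := L_cycles LC.
by have /imsetP[[x y] _ ->] := CE _ Cf; exists x, y.
Qed.

Lemma family_deg v : #|[set y | l v y]| = 2.
Proof.
have [C LC vC] := family_ex v; have [_ _ C2 _] := L_cycles LC.
rewrite -(C2 v vC) -(card_imset (f := fun y => [set v; y])); last first.
  move=> y z /setP yz; move: (yz y) (yz z); rewrite !inE !eqxx !orbT.
  by case: eqP => [-> _ | _ /esym/eqP-> //]; rewrite orbb => /eqP->.
congr #|pred_of_set _|; apply/setP=> f; apply/imsetP/idP.
  case=> y; rewrite inE (family_rel _ LC vC) => Cvy ->.
  by rewrite !inE Cvy eqxx.
rewrite inE => /andP[Cf]; have [x [y fE]] := family_edge LC Cf.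
rewrite fE in Cf *; rewrite !inE => /orP[] /eqP vE.
  by exists y; rewrite ?inE ?(family_rel _ LC vC) vE.
by exists x; rewrite ?inE ?(family_rel _ LC vC) vE setUC.
Qed.

Lemma family_connect C v y : C \in L -> v \in cover C ->
  connect l v y -> y \in cover C.
Proof.
move=> LC vC; move: y; apply: connect_closed_ind => // y z yC.
by rewrite (family_rel _ LC yC) => /mem_cover_edge[].
Qed.

Lemma family_cycle C v : C \in L -> v \in cover C -> C = cycle_at l v.
Proof.
move=> LC vC; have [_ _ _ Cconn] := L_cycles LC.
apply/setP=> f; apply/idP/imsetP=> [Cf | [[x y]]].
  have [x [y fE]] := family_edge LC Cf; rewrite fE in Cf *.
  have [xC _] := mem_cover_edge Cf.
  exists (x, y) => //; rewrite inE /= (family_rel _ LC xC) Cf andbT.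
  apply: (connect_morph (f := id)) (Cconn v x vC xC) => s t Cst.
  by apply/bigcupP; exists C.
rewrite inE /= => /andP[vx lxy] ->.
by rewrite -(family_rel y LC (family_connect LC vC vx)).
Qed.

(** Adjacency determines the family, so equalities of relations yield equalities of
    decompositions. *)
Lemma family_cycles_of : L = cycles_of l.
Proof.
apply/setP=> C; apply/idP/imsetP=> [LC | [v _ ->]].
  have [_ /set0Pn[f Cf] _ _] := L_cycles LC.
  have [x [y fE]] := family_edge LC Cf; rewrite fE in Cf.
  by exists x => //; apply: family_cycle => //; case: (mem_cover_edge Cf).
by have [D LD vD] := family_ex v; rewrite -(family_cycle LD vD).
Qed.

(* A reflection of C fixing v exchanges the successor and the predecessor of v
   on C, which are different as v has degree 2 in C. *)
Lemma reflection_move C v (g : {perm T}) : C \in L -> v \in cover C ->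
  g v = v ->
  reflection_on C g -> forall y, l v y -> g y != y.
Proof.
move=> LC vC gv [_ [s [s_uniq CE gs]]].
have sv : v \in s.
  case/bigcupP: vC => f; rewrite CE => /imsetP[x sx ->].
  by rewrite !inE => /orP[] /eqP-> //; rewrite mem_next.
have lE y : l v y -> y = next s v \/ y = prev s v.
  rewrite (family_rel _ LC vC) CE => /imsetP[x sx /setP xE].
  move: (xE v) (xE y) (xE x) (xE (next s x)); rewrite !inE !eqxx ?orbT /=.
  move=> /esym vx /esym yx xv xnv.
  case/orP: vx => /eqP vE.
    rewrite -vE in yx xnv.
    case/orP: yx => /eqP yE; last by left.
    by left; rewrite yE; apply/esym/eqP; move: xnv; rewrite yE orbb.
  have xE' : x = prev s v by rewrite vE prev_next.
  case/orP: yx => /eqP yE; first by right; rewrite yE.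
  rewrite -vE in yE; right; rewrite yE -xE'; apply/esym/eqP.
  by move: xv; rewrite yE orbb.
have np : next s v != prev s v.
  apply/eqP=> np; have := family_deg v.
  suff /subset_leq_card : [set y | l v y] \subset [set next s v].
    by rewrite cards1 => le1 deg2; rewrite deg2 in le1.
  by apply/subsetP=> y; rewrite !inE => /lE[] ->; rewrite ?np.
have gn : g (next s v) = prev s v by rewrite gs // gv.
move=> y /lE[] ->; first by rewrite gn eq_sym.
apply: contra np => /eqP gp; apply/eqP; apply: (@perm_inj _ g).
by rewrite gn gp.
Qed.

End CycleFamily.

Lemma stab_conj_sub (T : finType) (X Y : {set {perm T}}) (g : {perm T}) v :
  g v = v -> ('C_X[v | 'P] \subset Y -> 'C_(X :^ g)[v | 'P] \subset Y :^ g)%g.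
Proof.
move=> gv XY; have <- : ('C_X[v | 'P] :^ g = 'C_(X :^ g)[v | 'P])%g.
  by rewrite conjIg -astab1_act /= apermE gv.
by rewrite conjSg.
Qed.

(** * Passage from LR-structures to pairs of relations *)

Section Structures.

Variables (T : finType) (e : rel T).
Hypothesis e_sym : symmetric e.

Local Open Scope group_scope.

Lemma mem_edges x y : ([set x; y] \in edges e) = e x y.
Proof.
apply/imsetP/idP=> [[[a b]] | exy]; last by exists (x, y); rewrite ?inE.
rewrite inE /= => eab /setP xy; move: (xy x) (xy y) (xy a) (xy b).
rewrite !inE !eqxx ?orbT /= => /esym/orP[] /eqP-> /esym/orP[] /eqP-> //.
- by move=> _; rewrite orbb => /eqP ab; rewrite -{2}ab.
- by rewrite e_sym.
by rewrite orbb => /eqP ab _; rewrite -{1}ab.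
Qed.

Lemma cover_rel_act (L : {set {set {set T}}}) (g : {perm T}) x y :
  cover_rel (('P^*^*^*)%act L g) (g x) (g y) = cover_rel L x y.
Proof.
have memJ (C : {set {set T}}) f : (('P^*)%act f g \in ('P^*^*)%act C g) = (f
  \in C).
  by rewrite [('P^*^*)%act C g]setactE; apply: mem_imset; apply: act_inj.
rewrite /cover_rel -edge_act; apply/bigcupP/bigcupP => [[D] | [C LC Cxy]].
  by case/imsetP=> C LC ->; rewrite memJ; exists C.
by exists (('P^*^*)%act C g); rewrite ?memJ //; apply: mem_setact.
Qed.

Variables (CC L R : {set {set {set T}}}).
Hypothesis S : LR_structure e CC L R.

Local Notation l := (cover_rel L).
Local Notation r := (cover_rel R).

Lemma LR_structureU : CC = L :|: R.
Proof.
have [LR /and3P[/eqP <- _ _] _] := LR_split S.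
by rewrite /cover bigcup_setU !big_set1.
Qed.

Lemma LR_cyclesl : {in L, forall C, is_cycle e C}.
Proof.
have [_ cyc] := LR_cycles S.
by move=> C LC; apply: cyc; rewrite LR_structureU inE LC.
Qed.

Lemma LR_cyclesr : {in R, forall C, is_cycle e C}.
Proof.
have [_ cyc] := LR_cycles S.
by move=> C RC; apply: cyc; rewrite LR_structureU inE RC orbT.
Qed.

Lemma LR_vertexl v : #|[set C in L | v \in cover C]| = 1%N.
Proof. by have [_ _ /(_ v)[]] := LR_split S. Qed.

Lemma LR_vertexr v : #|[set C in R | v \in cover C]| = 1%N.
Proof. by have [_ _ /(_ v)[]] := LR_split S. Qed.

Lemma LR_cycle_disjoint C : C \in L -> C \notin R.
Proof.
have [LR /and3P[_ /trivIsetP LRdis _] _] := LR_split S.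
have := LRdis L R; rewrite !inE !eqxx orbT => /(_ isT isT LR).
by move=> dis LC; rewrite (disjointFr dis LC).
Qed.

Lemma LR_decomp_aut_sub : decomp_aut_plus e CC L R \subset graph_aut l :&:
  graph_aut r.
Proof.
apply/subsetP=> g; rewrite inE => /andP[_ /andP[/eqP Lg /eqP Rg]].
by apply/setIP; split; apply/graph_autP=> x y;
  rewrite -[RHS](cover_rel_act _ g) ?Lg ?Rg.
Qed.

(** Distinct cycles share no edge, which separates [l] from [r]; a reflection of one cycle at [v]
    fixes the other, which contains the component of [v] in the other relation. *)
Lemma LR_structure_pair : LR_pair e l r.
Proof.
have coverE x y : e x y = l x y || r x y.
  have [[/and3P[/eqP CE _ _] _] _] := (LR_cycles S, tt).
  rewrite -mem_edges -CE LR_structureU /cover_rel -in_setU.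
  by rewrite /cover -bigcup_setU.
have aut_sub := subsetP LR_decomp_aut_sub.
have cc_of C : C \in L \/ C \in R -> C \in CC.
  by rewrite LR_structureU inE => -[] ->; rewrite ?orbT.
split=> //.
- move=> x y /bigcupP[C LC Cxy]; apply/negP=> /bigcupP[D RD Dxy].
  have [[/and3P[_ /trivIsetP CCdis _] _] _] := (LR_cycles S, tt).
  have CD : C != D by apply: contraTneq RD => <-; apply: LR_cycle_disjoint.
  have dis := CCdis C D (cc_of _ (or_introl LC)) (cc_of _ (or_intror RD)) CD.
  by have := disjointFr dis Cxy; rewrite Dxy.
- exact: cover_rel_sym.
- exact: cover_rel_sym.
- exact (family_deg LR_cyclesl LR_vertexl).
- exact (family_deg LR_cyclesr LR_vertexr).
- have [v _ /setP orb] := imsetP (LR_transitive S) => x y.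
  have /imsetP[g Ag ->] : x \in orbit 'P (decomp_aut_plus e CC L R) v.
    by rewrite -orb inE.
  have /imsetP[h Ah ->] : y \in orbit 'P (decomp_aut_plus e CC L R) v.
    by rewrite -orb inE.
  exists (g^-1 * h); first exact: groupM (groupVr (aut_sub _ Ag)) (aut_sub _
    Ah).
  by rewrite /= !apermE permM permK.
- move=> v; have [C LC vC] := family_ex LR_vertexl v.
  have [D RD vD] := family_ex LR_vertexr v.
  have [g [Ag gv gC gD]] := LR_reflections S (cc_of _ (or_introl LC)) vC.
  exists g; split; first exact: aut_sub.
    move=> y vy; apply: (gD D) => //; first by apply: cc_of; right.
      by apply: contraTneq RD => ->; apply: LR_cycle_disjoint.
    exact (family_connect LR_vertexr RD vD vy).
  exact (reflection_move LR_cyclesl LR_vertexl LC vC gv gC).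
move=> v; have [C LC vC] := family_ex LR_vertexl v.
have [D RD vD] := family_ex LR_vertexr v.
have [g [Ag gv gD gC]] := LR_reflections S (cc_of _ (or_intror RD)) vD.
exists g; split; first exact: aut_sub.
  move=> y vy; apply: (gC C) => //; first by apply: cc_of; left.
    by apply: contraTneq LC => ->; apply: contraL RD; apply: LR_cycle_disjoint.
  exact (family_connect LR_vertexl LC vC vy).
exact (reflection_move LR_cyclesr LR_vertexr RD vD gv gD).
Qed.

Lemma LR_cycles_ofl : L = cycles_of l.
Proof. exact (family_cycles_of LR_cyclesl LR_vertexl). Qed.

Lemma LR_cycles_ofr : R = cycles_of r.
Proof. exact (family_cycles_of LR_cyclesr LR_vertexr). Qed.

Lemma LR_structure_act (g : {perm T}) l' r' :
    (forall x y, l' (g x) (g y) = l x y) -> (forall x y, r' (g x) (g y) = r x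
      y) ->
  ('P^*^*^*)%act CC g = cycles_of l' :|: cycles_of r'.
Proof.
move=> ll' rr'; rewrite LR_structureU [LHS]setactE imsetU -!setactE.
by rewrite {1}LR_cycles_ofl {1}LR_cycles_ofr (cycles_of_act ll') (cycles_of_act
  rr').
Qed.

(** Automorphisms of both relations preserve the families rebuilt from them. *)
Lemma LR_decomp_aut_plusE :
  decomp_aut_plus e CC L R = graph_aut l :&: graph_aut r.
Proof.
apply/eqP; rewrite eqEsubset LR_decomp_aut_sub; apply/subsetP=> g Gg.
have [/graph_autP lg /graph_autP rg] := setIP Gg.
rewrite 2!inE (subsetP (pair_sub_aut LR_structure_pair)) //=.
rewrite (LR_structure_act lg rg) -LR_cycles_ofl -LR_cycles_ofr -LR_structureU
  eqxx.
rewrite {1}LR_cycles_ofl {1}LR_cycles_ofr (cycles_of_act lg) (cycles_of_act rg).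
by rewrite -LR_cycles_ofl -LR_cycles_ofr !eqxx.
Qed.

End Structures.

(** * Conjugacy of decompositions and self-duality *)

Theorem theorem1p8 (T : finType) (e : rel T)
    (e_sym : symmetric e) (e_irr : irreflexive e) :
  (forall CC CC' : {set {set {set T}}},
     tetravalent e -> LR_decomposition e CC -> LR_decomposition e CC' ->
     CC <> CC' ->
     exists2 g : {perm T}, g \in graph_aut e & ('P^*^*^*)%act CC g = CC') /\
  (forall CC L R : {set {set {set T}}},
     LR_structure e CC L R ->
     decomp_aut_plus e CC L R \proper graph_aut e ->
     self_dual e CC L R).
Proof.
split.
  move=> CC CC' _ [L [R S]] [L' [R' S']] _.
  have P := LR_structure_pair e_sym S; have P' := LR_structure_pair e_sym S'.
  have [v _ _] := imsetP (LR_transitive S).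
  have e_conn := LR_connected S.
  have [Q sylQ GQ] :=
    Sylow_superset (setSI _ (pair_sub_aut P)) (pair_stab_2group P e_conn v).
  have [Q' sylQ' GQ'] :=
    Sylow_superset (setSI _ (pair_sub_aut P')) (pair_stab_2group P' e_conn v).
  (* [a] fixes [v], and transport by [a] brings both vertex groups into [Q']. *)
  have [a Aa Q'E] := Sylow_trans sylQ sylQ'.
  have [Aa1 /eqP av] : a \in graph_aut e /\ a v == v.
    by apply/andP; rewrite -mem_perm_stab1.
  exists a => //; have P1 := LR_pair_conj Aa1 P.
  have G1Q : ('C_(graph_aut (conj_rel a (cover_rel L)) :&:
                 graph_aut (conj_rel a (cover_rel R)))[v | 'P] \subset Q')%g.
    by rewrite !graph_aut_conj -conjIg Q'E; apply: stab_conj_sub.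
  (* This L'-neighbour of [v] is adjacent to [v] in one of the transported relations; in the second
     case L and R are exchanged. *)
  have [x l'x] := pair_nbr v P'.
  have : e v x by rewrite (pair_edge P') l'x.
  rewrite (pair_edge P1) => /orP[lx | rx].
    have [ll rr] := LR_pair_unique P1 P' e_conn sylQ' G1Q GQ' lx l'x.
    rewrite (LR_structureU S') (LR_cycles_ofl S') (LR_cycles_ofr S').
    by apply: (LR_structure_act S) => s t; rewrite -?ll -?rr conj_relE.
  have [|rl lr] := LR_pair_unique (LR_pairC P1) P' e_conn sylQ' _ GQ' rx l'x.
    by rewrite [X in (X :&: _)%g]setIC.
  rewrite (LR_structureU S') (LR_cycles_ofl S') (LR_cycles_ofr S') setUC.
  by apply: (LR_structure_act S) => s t; rewrite -?rl -?lr conj_relE.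
move=> CC L R S; have P := LR_structure_pair e_sym S.
rewrite /self_dual (LR_decomp_aut_plusE e_sym S) => /properP[_ [c Ac notGc]].
have [v _ _] := imsetP (LR_transitive S).
have [u lvu] := pair_nbr v P.
have e_conn := LR_connected S.
have [Q sylQ GQ] :=
  Sylow_superset (setSI _ (pair_sub_aut P)) (pair_stab_2group P e_conn v).
have [_ orbQ] := Sylow_astab1 sylQ (pnat_orbit_stab P lvu).
(* If the stabilizer of [v] took [u] to L-neighbours only, all automorphisms would preserve L and R,
   against [c]; and [Q] has the same orbit of [u]. *)
have [b Qb rb] : exists2 b, b \in Q & cover_rel R v (b u).
  have [/exists_inP[d Cd rd] | no_d] :=
      boolP [exists d in 'C_(graph_aut e)[v | 'P]%g, cover_rel R v (d u)].
    have : d u \in orbit 'P Q u by rewrite orbQ; apply: mem_orbit.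
    by case/orbitP=> b Qb; rewrite /= apermE => bu; exists b; rewrite ?bu.
  case/negP: notGc; apply: (subsetP (stab_invariant_l P lvu _)) Ac => d Ad dv.
  have : e v (d u) by rewrite -{1}dv (graph_autP _ _ Ad) (pair_edge P) lvu.
  rewrite (pair_edge P) => /orP[// | rd]; case/negP: no_d; apply/exists_inP.
  by exists d; rewrite // mem_perm_stab1 Ad dv eqxx.
have /andP[Ab /eqP bv] : (b \in graph_aut e) && (b v == v).
  by rewrite -mem_perm_stab1 (subsetP (pHall_sub sylQ)).
have P1 := LR_pair_conj Ab P.
(* [b] normalizes [Q], and [b u] is a neighbour of [v] both in the image of L under [b] and in R. By
   uniqueness, the image of the pair under [b] is the exchanged pair. *)
have [|||ll rr] := LR_pair_unique P1 (LR_pairC P) e_conn sylQ _ _ _ rb.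
- by rewrite !graph_aut_conj -conjIg -(conjGid Qb); apply: stab_conj_sub.
- by rewrite [X in (X :&: _)%g]setIC.
- by rewrite -{1}bv conj_relE.
apply/properP; split.
  apply/subsetP=> g; rewrite -(LR_decomp_aut_plusE e_sym S).
  by rewrite inE => /andP[].
exists b.
  rewrite inE Ab (LR_structure_act S (l' := cover_rel R) (r' := cover_rel L)).
  - by rewrite setUC -(LR_cycles_ofl S) -(LR_cycles_ofr S) -(LR_structureU S)
      eqxx.
  - by move=> s t; rewrite -ll conj_relE.
  by move=> s t; rewrite -rr conj_relE.
apply: contraL rb => /setIP[/graph_autP lb _].
by apply: (pair_disj P); rewrite -{1}bv lb.
Qed.
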